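(* Let $q$ be an odd prime power, $\delta\in\mathbb{F}_{q^2}$ and $\gamma\in\mathbb{F}_q^*$. Then the polynomial $$f(x)=(x^q-x+\delta)^{q+5}+(x^q-x+\delta)^{2q}+\gamma x$$ is a permutation polynomial of $\mathbb{F}_{q^2}$ if and only if one of the following holds: (i) $\mathrm{Tr}_q^{q^2}(\delta)=0$; (ii) $\mathrm{Tr}_q^{q^2}(\delta)\neq0$, $q\not\equiv1\pmod 5$ and $\gamma=\left(\mathrm{Tr}_q^{q^2}(\delta)\right)^5/4-2\,\mathrm{Tr}_q^{q^2}(\delta)$; (iii) $\mathrm{Tr}_q^{q^2}(\delta)\neq0$, $5\mid q$ and $\left(\left(\mathrm{Tr}_q^{q^2}(\delta)\right)^5+2\,\mathrm{Tr}_q^{q^2}(\delta)+\gamma\right)/\mathrm{Tr}_q^{q^2}(\delta)$ is a fourth power or not a square in $\mathbb{F}_q$; (iv) $\mathrm{Tr}_q^{q^2}(\delta)\neq0$, $q=9$ and either $\gamma=\left(\mathrm{Tr}_q^{q^2}(\delta)\right)^5$ or $\gamma=\left(\mathrm{Tr}_q^{q^2}(\delta)\right)^5-\mathrm{Tr}_q^{q^2}(\delta)$.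
   Context: A polynomial over a finite field $\mathbb{F}$ is a permutation polynomial of $\mathbb{F}$ if the map it induces on $\mathbb{F}$ is a bijection. For $x\in\mathbb{F}_{q^2}$, $\mathrm{Tr}_q^{q^2}(x)=x+x^q$. *)

(* Defs.v *)
From HB Require Import structures.
From mathcomp Require Import all_boot all_order all_algebra all_field.

Set Implicit Arguments.
Unset Strict Implicit.
Unset Printing Implicit Defensive.

Import GRing.Theory.
Local Open Scope ring_scope.

Definition prime_power (q : nat) : Prop :=
  exists p m : nat, [/\ prime p, (0 < m)%N & q = (p ^ m)%N].

(* The copy of F_q inside a finite field L with q ^ 2 elements: a subset K of L
   that is a subfield (closed under 1, subtraction and division) of order q. *)
Definition subfield_of_order (L : finFieldType) (q : nat) (K : {set L}) : Prop :=
  divring_closed K /\ #|K| = q.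

Definition permutation_poly (L : finFieldType) (f : {poly L}) : Prop :=
  bijective (fun x : L => f.[x]).

(* Trace from F_{q^2} to F_q; its value is kept as an element of F_{q^2}. *)
Definition Tr (L : finFieldType) (q : nat) (x : L) : L := x + x ^+ q.

Definition power_in (L : finFieldType) (K : {set L}) (n : nat) (z : L) : Prop :=
  exists2 y : L, y \in K & z = y ^+ n.

(* Main.v *)
Require Import Defs.
From HB Require Import structures.
From mathcomp Require Import all_boot all_order all_algebra all_field.
From mathcomp Require Import cyclic zify ring.

(* Write T = Tr delta and y = x^q - x + delta = T / 2 + z, so that z^q = - z.
   Then f^q - f is, up to a constant, G(z) = 4 T z^5 + A z with
   A = gamma + 2 T - T^5 / 4, and f is a permutation polynomial exactly when G is
   injective on V = {z | z^q = - z}.  If T = 0 then G(z) = gamma z.  Otherwise one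
   must decide when H(z) = z^5 + a z, a = A / (4 T), is injective on V.
   If 5 | q, H is additive and - a must not be the fourth power of a nonzero element
   of V.  If not, injectivity of H makes its power sums over V agree with those of
   the identity, so sum_(z in V) H(z)^k = 0 for 0 < k < q - 1.  With a <> 0,
   r = (q - 1) mod 5 and 5 k = q - 1 + 4 r, only one binomial coefficient,
   'C(k, r), survives, and it is nonzero in characteristic p unless p = 3 (r = 1),
   p = 7 (r = 2) or q is 3 or 9.
   Those two characteristics are eliminated with k = (q + 1) / 2 and
   k = (q - 1) / 3, for which Lucas' theorem evaluates the surviving coefficient. *)

Set Implicit Arguments.
Unset Strict Implicit.
Unset Printing Implicit Defensive.

Import GRing.Theory.
Local Open Scope ring_scope.

(** * Binomial coefficients modulo a prime *)

Lemma coef_exp1DX (R : comNzRingType) (n j : nat) :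
  ((1 + 'X : {poly R}) ^+ n)`_j = 'C(n, j)%:R.
Proof.
have -> : (1 + 'X : {poly R}) ^+ n = \poly_(i < n.+1) 'C(n, i)%:R.
  rewrite poly_def exprDn; apply: eq_bigr => i _.
  by rewrite expr1n mul1r scaler_nat.
by rewrite coef_poly ltnS; case: leqP => // /bin_small ->.
Qed.

(** Compare coefficients in [(1 + X)^(k p + a) = (1 + X^p)^k (1 + X)^a]: as [a, b < p], only the
    term in [X^(p i)] of the first factor contributes to degree [i p + b]. *)
Lemma lucas_step (R : comNzRingType) (p k a i b : nat) :
  p \in [pchar R] -> (a < p)%N -> (b < p)%N ->
  'C(k * p + a, i * p + b)%:R = 'C(k, i)%:R * 'C(a, b)%:R :> R.
Proof.
move=> pcharR lt_ap lt_bp; have p_pr := pcharf_prime pcharR.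
have expXp : (1 + 'X : {poly R}) ^+ p = 1 + 'X^p.
  by rewrite exprDn_pchar ?expr1n // pnatE ?pchar_poly.
rewrite -coef_exp1DX exprD mulnC exprM expXp exprDn mulr_suml coef_sum.
have term (j : 'I_k.+1) : (1 ^+ (k - j) * 'X^p ^+ j *+ 'C(k, j) * (1 + 'X) ^+ a)
    `_(i * p + b) = if j == i :> nat then 'C(k, i)%:R * 'C(a, b)%:R else 0 :> R.
  rewrite expr1n mul1r -exprM mulrnAl coefMn coefXnM coef_exp1DX.
  case: eqP => [->|ne_ji].
    by rewrite ltnNge (mulnC p i) leq_addr addKn /= mulr_natl.
  case: ltnP => [_|le_pj]; first by rewrite mul0rn.
  by rewrite bin_small ?mul0rn //; nia.
rewrite (eq_bigr _ (fun j _ => term j)).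
have [lt_ik | /bin_small C0] := ltnP i k.+1; last first.
  by rewrite C0 mul0r big1 // => j _; case: ifP.
rewrite (bigD1 (Ordinal lt_ik)) //= eqxx big1 ?addr0 // => j.
by rewrite -val_eqE /= => /negPf ->.
Qed.

(** In base 3 the upper index is [11] repeated [s] times followed by [2], the lower one [01]
    repeated [s] times followed by [0]; every digit contributes a factor 1. *)
Lemma bin3_repunit (R : comNzRingType) (s : nat) : 3%N \in [pchar R] ->
  'C((3 ^ s.*2.+1 + 1) %/ 2, (3 ^ s.*2.+1 - 3) %/ 8)%:R = 1 :> R.
Proof.
move=> pchar3.
have repunit : exists k i : nat,
    [/\ (2 * k + 1 = 3 ^ s.*2)%N, (4 * i = k)%N & 'C(k, i)%:R = 1 :> R].
  elim: s => [|s [k [i [Ek Ei IH]]]]; first by exists 0%N, 0%N.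
  exists ((k * 3 + 1) * 3 + 1)%N, ((i * 3 + 0) * 3 + 1)%N.
  split; [by rewrite doubleS !expnS -Ek; lia | by lia |].
  by rewrite !lucas_step // IH !mul1r.
have [k [i [Ek Ei C1]]] := repunit.
have -> : ((3 ^ s.*2.+1 + 1) %/ 2 = k * 3 + 2)%N by rewrite expnS -Ek; lia.
have -> : ((3 ^ s.*2.+1 - 3) %/ 8 = i * 3 + 0)%N by rewrite expnS -Ek; lia.
by rewrite lucas_step // C1 mul1r.
Qed.

(** In base 7 the indices are [2...2] and [1...1], and each of the [m] digits contributes
    ['C(2, 1) = 2]. *)
Lemma bin7_repunit (R : comNzRingType) (m : nat) : 7%N \in [pchar R] ->
  'C((7 ^ m - 1) %/ 3, (7 ^ m - 1) %/ 6)%:R = 2%:R ^+ m :> R.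
Proof.
move=> pchar7.
have [i [Ei <-]] : exists i : nat,
    (6 * i + 1 = 7 ^ m)%N /\ 'C(2 * i, i)%:R = 2%:R ^+ m :> R.
  elim: m => [|m [i [Ei IH]]]; first by exists 0%N.
  exists (i * 7 + 1)%N; rewrite expnS -Ei; split; first lia.
  have -> : (2 * (i * 7 + 1) = (2 * i) * 7 + 2)%N by lia.
  by rewrite lucas_step // IH exprSr.
by rewrite -Ei; congr ('C(_, _)%:R); lia.
Qed.

(** * Frobenius and the trace-zero elements of F_{q^2} *)

(** The kernel of the trace to F_q, which is also the set of values of [x^q - x]. *)
Definition antifixed (L : finFieldType) (q : nat) : {set L} :=
  [set z | z ^+ q == - z].

Lemma power_inP (L : finFieldType) (K : {set L}) (n : nat) (z : L) :
  reflect (power_in K n z) [exists y in K, z == y ^+ n].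
Proof.
by apply: (iffP exists_inP) => -[y Ky Ez]; exists y => //; apply/eqP.
Qed.

Section QuadraticExtension.

Variables (L : finFieldType) (q : nat).
Hypotheses (q_pp : prime_power q) (q_odd : odd q) (cardL : #|L| = (q ^ 2)%N).

Local Notation V := (antifixed L q).

Lemma prime_power_pchar : exists p m : nat,
  [/\ prime p, odd p, (0 < m)%N, q = (p ^ m)%N & p \in [pchar L]].
Proof.
have [p [m [p_pr m_gt0 Eq]]] := q_pp.
exists p, m; split=> //.
  by move: q_odd; rewrite Eq oddX (gtn_eqF m_gt0).
by apply: (@card_finPcharP _ p (m * 2)); rewrite // cardL Eq expnM.
Qed.

Lemma q_ge3 : (2 < q)%N.
Proof.
have [p [m [p_pr p_odd m_gt0 Eq _]]] := prime_power_pchar.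
have : (p ^ 1 <= q)%N by rewrite Eq leq_exp2l // prime_gt1.
by move: q_odd (prime_gt1 p_pr); case: (q) => [|[|[|]]] //; lia.
Qed.

Lemma pchar_dvdq (l : nat) : prime l -> (l %| q)%N -> l \in [pchar L].
Proof.
have [p [m [p_pr _ m_gt0 -> pcharL]]] := prime_power_pchar.
by move=> l_pr; rewrite Euclid_dvdX // m_gt0 andbT dvdn_prime2 // => /eqP ->.
Qed.

Lemma expqD (x y : L) : (x + y) ^+ q = x ^+ q + y ^+ q.
Proof.
have [p [m [p_pr _ m_gt0 Eq pcharL]]] := prime_power_pchar.
by rewrite exprDn_pchar // Eq pnatX pnatE // pcharL.
Qed.

Lemma expqN (x : L) : (- x) ^+ q = - x ^+ q.
Proof. by rewrite exprNn -signr_odd q_odd mulN1r. Qed.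

Lemma expqB (x y : L) : (x - y) ^+ q = x ^+ q - y ^+ q.
Proof. by rewrite expqD expqN. Qed.

Lemma expqK (x : L) : (x ^+ q) ^+ q = x.
Proof. by rewrite -exprM -[RHS]expf_card cardL. Qed.

Lemma expq_nat (n : nat) : n%:R ^+ q = n%:R :> L.
Proof.
have q0 : q != 0%N by have := q_ge3; case: (q).
elim: n => [|n IH]; first by rewrite expr0n (negPf q0).
by rewrite -addn1 natrD expqD IH expr1n.
Qed.

Lemma natr2_neq0 : 2%:R != 0 :> L.
Proof.
have [p [m [p_pr p_odd _ _ pcharL]]] := prime_power_pchar.
rewrite -(dvdn_pcharf pcharL); apply/negP => /dvdn_leq => /(_ isT) le2.
by move: p_odd (prime_gt1 p_pr); case: p le2 {p_pr pcharL} => [|[|[|]]].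
Qed.

Lemma natr4_neq0 : 4%:R != 0 :> L.
Proof. by rewrite (natrM _ 2 2) mulf_neq0 ?natr2_neq0. Qed.

(** Multiplication by a nonzero [y] in [K] permutes the nonzero elements of [K], and comparing
    products gives [y^(q-1) = 1]. Conversely, the [q] elements of [K] already exhaust the roots of
    [X^q - X]. *)
Lemma subfield_fixed (K : {set L}) (x : L) :
  subfield_of_order q K -> (x \in K) = (x ^+ q == x).
Proof.
case=> [[K1 KB Kdiv] cardK].
have K0 : 0 \in K by rewrite -(subrr 1) KB.
have q0 : (0 < q)%N by have := q_ge3; lia.
have fixK y : y \in K -> y ^+ q = y.
  move=> Ky; have [->|y0] := eqVneq y 0; first by rewrite expr0n gtn_eqF.
  have KV : y^-1 \in K by rewrite -div1r Kdiv.
  have KM u : (y * u \in K) = (u \in K).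
    apply/idP/idP => Ku; first by rewrite -(mulKf y0 u) mulrC Kdiv.
    by rewrite -(invrK y) mulrC Kdiv.
  have prod0 : \prod_(u in K | u != 0) u != 0.
    by rewrite prodf_seq_neq0; apply/allP => u _; apply/implyP => /andP[].
  have cardK' : #|[pred u in K | u != 0]| = q.-1.
    rewrite -cardK (cardD1 0 K) K0 /=; apply: eq_card => u.
    by rewrite !inE andbC.
  have : \prod_(u in K | u != 0) u = y ^+ q.-1 * \prod_(u in K | u != 0) u.
    rewrite {1}(reindex_inj (mulfI y0)) -cardK' -prodr_const -big_split /=.
    by apply: eq_bigl => u; rewrite KM mulf_eq0 (negPf y0).
  rewrite -{1}[LHS]mul1r => /(mulIf prod0) y1.
  by rewrite -(prednK q0) exprS -y1 mulr1.
apply/idP/eqP => [/fixK //|fix_x]; apply/negPn/negP => nKx.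
have sizeP : size ('X^q - 'X : {poly L}) = q.+1.
  by rewrite size_polyDl size_polyXn // size_polyN size_polyX ltnS ltnW ?q_ge3.
have P0 : ('X^q - 'X : {poly L}) != 0 by rewrite -size_poly_eq0 sizeP.
have : (size (x :: enum K) < size ('X^q - 'X : {poly L})%R)%N.
  apply: max_poly_roots => //; last by rewrite /= mem_enum nKx enum_uniq.
  apply/allP => y; rewrite inE mem_enum rootE !hornerE => Hy.
  rewrite subr_eq0; apply/eqP.
  by case/orP: Hy => [/eqP -> //|/fixK].
by rewrite sizeP /= -cardE cardK ltnn.
Qed.

Lemma primitive_root_exists : exists g : L, (q ^ 2 - 1).-primitive_root g.
Proof.
have q1 : (0 < q ^ 2 - 1)%N by have := q_ge3; nia.
have /hasP[g _ gP] : has (q ^ 2 - 1).-primitive_root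
    [seq x <- enum L | x != 0].
  apply: has_prim_root => //.
  - apply/allP => x; rewrite mem_filter => /andP[x0 _].
    rewrite unity_rootE -(inj_eq (mulfI x0)) mulr1 -exprS.
    by rewrite subn1 prednK -?cardL ?expf_card //; lia.
  - by rewrite filter_uniq ?enum_uniq.
  - rewrite size_filter -(leq_add2r (count (pred1 0) (enum L))).
    rewrite [leqRHS]addnC (count_predC (pred1 0)) -cardE cardL.
    rewrite count_uniq_mem ?enum_uniq // mem_enum.
    by rewrite subnK //; lia.
by exists g.
Qed.

Lemma antifixed0 : 0 \in V.
Proof. by rewrite inE oppr0 expr0n; have := q_ge3; case: (q). Qed.

Lemma exists_antifixed : exists x : L, x ^+ q - x != 0.
Proof.
have [g gP] := primitive_root_exists; exists g.
rewrite subr_eq0 -{2}(expr1 g) (eq_prim_root_expr gP) !modn_small //;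
  have := q_ge3; nia.
Qed.

(** The quotient of two elements of [V] is fixed by Frobenius, so one nonzero value of [x^q - x] can
    be rescaled to [z]. *)
Lemma antifixed_image (z : L) : z \in V -> exists x, x ^+ q - x = z.
Proof.
rewrite inE => /eqP zq; have [x x0] := exists_antifixed.
exists (z / (x ^+ q - x) * x).
have fix_c : (z / (x ^+ q - x)) ^+ q = z / (x ^+ q - x).
  rewrite exprMn exprVn zq expqB expqK -(opprB (x ^+ q) x).
  by rewrite invrN mulrNN.
by rewrite exprMn fix_c -mulrBr divfK.
Qed.

Lemma antifixed_powq1 (z : L) : z \in V -> z != 0 -> z ^+ (q - 1) = -1.
Proof.
rewrite inE => /eqP zq z0; apply: (mulfI z0).
by rewrite -exprS subn1 prednK ?mulrN1 //; have := q_ge3; lia.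
Qed.

(** Translation by a nonzero [v] in [V] permutes [V]; comparing the sums of all elements gives
    [#|V| v = 0]. *)
Lemma card_antifixed : #|V|%:R = 0 :> L.
Proof.
have [x] := exists_antifixed.
have: (x ^+ q - x) ^+ q = - (x ^+ q - x) by rewrite expqB expqK opprB.
move: (x ^+ q - x) => v vV v0.
have : \sum_(z in V) z = \sum_(z in V) (z + v).
  rewrite (reindex_inj (addIr v)); apply: eq_bigl => z.
  by rewrite !inE expqD vV opprD; apply/eqP/eqP => [/(addIr (- v))|->].
rewrite big_split /= sumr_const -{1}[LHS]addr0 => /addrI/esym/eqP.
by rewrite -[v *+ _]mulr_natl mulf_eq0 (negPf v0) orbF => /eqP.
Qed.

(** If [q - 1] divides [e], all nonzero [z] contribute the same sign, and their number is -1 in [L].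
    Otherwise scaling [V] by [u = g^(q+1)], a generator of F_q^*, multiplies the sum by
    [u^e != 1]. *)
Lemma sum_antifixed_exp (e : nat) : (0 < e)%N ->
  \sum_(z in V) z ^+ e =
    if (q - 1 %| e)%N then - (-1) ^+ (e %/ (q - 1)) else 0 :> L.
Proof.
move=> e_gt0; case: ifP => [/dvdnP[n En]|ndvd].
  have q1 : (0 < q - 1)%N by have := q_ge3; lia.
  rewrite En mulnK // (bigD1 0) ?antifixed0 //= expr0n gtn_eqF -?En // add0r.
  rewrite (eq_bigr (fun=> (-1) ^+ n)) => [|z /andP[zV z0]]; last first.
    by rewrite En mulnC exprM antifixed_powq1.
  apply/eqP; rewrite -subr_eq0 opprK addrC.
  have := sumr_const (mem V) ((-1) ^+ n : L).
  rewrite (bigD1 0) ?antifixed0 //= => ->.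
  by rewrite -mulr_natl card_antifixed mul0r.
have [g gP] := primitive_root_exists.
have q3 := q_ge3.
pose u := g ^+ (q + 1).
have u0 : u != 0.
  apply/expf_neq0/negP => /eqP g0.
  have := prim_expr_order gP; rewrite g0 expr0n => /eqP.
  rewrite gtn_eqF ?(eq_sym 0) ?oner_eq0 //; nia.
have Eq2 : (q ^ 2 - 1 = (q + 1) * (q - 1))%N by nia.
have ue : (u ^+ e != 1).
  by rewrite -exprM -(prim_order_dvd gP) Eq2 dvdn_pmul2l ?ndvd //; lia.
have uq : u ^+ q = u.
  apply/eqP; rewrite -exprM (eq_prim_root_expr gP) Eq2 eqn_mod_dvd; last by nia.
  by apply/dvdnP; exists 1%N; nia.
have : \sum_(z in V) z ^+ e = u ^+ e * \sum_(z in V) z ^+ e.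
  rewrite {1}(reindex_inj (mulfI u0)) mulr_sumr; apply: eq_big => z.
    by rewrite !inE exprMn uq -mulrN; apply/eqP/eqP => [/(mulfI u0)|->].
  by rewrite exprMn.
rewrite -{1}[LHS]mul1r => /eqP; rewrite -subr_eq0 -mulrBl mulf_eq0 subr_eq0.
by rewrite eq_sym (negPf ue) => /eqP.
Qed.

(** * Injectivity of [z^5 + a z] on the trace-zero elements *)

Section Quintic.

Variable a : L.
Hypothesis aq : a ^+ q = a.

Local Notation H := (fun z : L => z ^+ 5 + a * z).

Lemma quintic_antifixed (z : L) : z \in V -> H z \in V.
Proof.
rewrite !inE => /eqP zq.
by rewrite expqD -exprM mulnC exprM zq exprMn aq zq; apply/eqP; ring.
Qed.

(* Hermite's criterion: if H permutes V then H and the identity have the same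
   power sums over V. *)
Lemma hermite (k : nat) : {in V &, injective H} -> (0 < k < q - 1)%N ->
  \sum_(i < k.+1 | (q - 1 %| k + 4 * i)%N)
    'C(k, i)%:R * a ^+ (k - i) * (-1) ^+ ((k + 4 * i) %/ (q - 1)) = 0.
Proof.
move=> injH /andP[k0 kq].
have imH : H @: V = V.
  apply/eqP; rewrite eqEcard card_in_imset // leqnn andbT.
  by apply/subsetP => _ /imsetP[z zV ->]; apply: quintic_antifixed.
have : \sum_(z in V) (H z) ^+ k = 0.
  rewrite -(big_imset (fun z => z ^+ k) injH) imH sum_antifixed_exp //.
  by rewrite gtnNdvd.
have expH (z : L) : (H z) ^+ k =
    \sum_(i < k.+1) 'C(k, i)%:R * a ^+ (k - i) * z ^+ (k + 4 * i).
  rewrite addrC exprDn; apply: eq_bigr => i _; rewrite exprMn -exprM.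
  have -> : (k + 4 * i = k - i + 5 * i)%N by have := ltn_ord i; lia.
  by rewrite exprD -mulr_natl; ring.
under eq_bigr => z _ do rewrite expH.
rewrite exchange_big /=.
under eq_bigr => i _.
  rewrite -mulr_sumr sum_antifixed_exp ?addn_gt0 ?k0 // (fun_if (GRing.mul _)).
  rewrite mulr0 mulrN; over.
by rewrite -big_mkcond sumrN => /eqP; rewrite oppr_eq0 => /eqP.
Qed.

(** A single surviving index leaves a single monomial in [a], whose sign is a unit. *)
Lemma hermite_single (k i0 : nat) : {in V &, injective H} ->
  (0 < k < q - 1)%N -> (i0 <= k)%N -> (q - 1 %| k + 4 * i0)%N ->
  (forall i, (i <= k)%N -> (q - 1 %| k + 4 * i)%N -> i = i0) ->
  'C(k, i0)%:R * a ^+ (k - i0) = 0.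
Proof.
move=> injH kq le_i0 dvd0 uniq0.
have := hermite injH kq; rewrite (bigD1 (inord i0)) ?inordK //= big1 => [|i].
  by rewrite addr0 => /eqP; rewrite mulf_eq0 signr_eq0 orbF => /eqP.
case/andP=> dvdi; rewrite -val_eqE /= inordK // => ne_i.
by move: ne_i; rewrite (uniq0 i) ?eqxx // -ltnS.
Qed.

Lemma quintic_inj_pow3 (s : nat) : 3%N \in [pchar L] -> (0 < s)%N ->
  q = (3 ^ s.*2.+1)%N -> {in V &, injective H} -> a = 0.
Proof.
move=> pchar3 s_gt0 Eq injH.
have [t Et t_ge3] : exists2 t, q = (8 * t + 3)%N & (3 <= t)%N.
  have [t Et] : exists t, (9 ^ s = 8 * t + 1)%N.
    elim: {+}s => [|n [t Et]]; first by exists 0%N.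
    by exists (9 * t + 1)%N; rewrite expnS Et; lia.
  have le9 : (9 ^ 1 <= 9 ^ s)%N by rewrite leq_exp2l.
  by exists (3 * t)%N; rewrite ?Eq -?muln2 ?expnS ?(mulnC s) ?expnM ?Et; lia.
have := bin3_repunit s pchar3; rewrite -Eq.
set k := (_ %/ 2)%N; set i0 := (_ %/ 8)%N => C1.
have Ek : k = (4 * t + 2)%N by rewrite /k; lia.
have Ei : i0 = t by rewrite /i0; lia.
have /eqP : 'C(k, i0)%:R * a ^+ (k - i0) = 0.
  apply: hermite_single => //; rewrite ?Ek ?Ei; [lia | lia | |].
    by apply/dvdnP; exists 1%N; lia.
  (* With [q - 1 = 8 t + 2] and [k = 4 t + 2], the value [2 (q - 1)] is excluded modulo 4 and
     [3 (q - 1)] exceeds [5 k]. *)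
  move=> i le_i /dvdnP[n En].
  case: n En => [|[|[|n]]] En; [lia | lia | lia | nia].
by rewrite C1 mul1r expf_eq0 => /andP[_ /eqP].
Qed.

Lemma quintic_inj_pow7 (m : nat) : 7%N \in [pchar L] ->
  q = (7 ^ m)%N -> {in V &, injective H} -> a = 0.
Proof.
move=> pchar7 Eq injH; have q3 := q_ge3.
have [t Et] : exists t, q = (6 * t + 1)%N.
  rewrite Eq; elim: (m) => [|n [t Et]]; first by exists 0%N.
  by exists (7 * t + 1)%N; rewrite expnS Et; lia.
have := bin7_repunit m pchar7; rewrite -Eq.
set k := (_ %/ 3)%N; set i0 := (_ %/ 6)%N => C2.
have Ek : k = (2 * t)%N by rewrite /k; lia.
have Ei : i0 = t by rewrite /i0; lia.
have /eqP : 'C(k, i0)%:R * a ^+ (k - i0) = 0.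
  apply: hermite_single => //; rewrite ?Ek ?Ei; [lia | lia | |].
    by apply/dvdnP; exists 1%N; lia.
  move=> i le_i /dvdnP[n En].
  case: n En => [|[|n]] En; [lia | lia | nia].
rewrite C2 mulf_eq0 expf_eq0 (negPf natr2_neq0) andbF /=.
by rewrite expf_eq0 => /andP[_ /eqP].
Qed.

(** The surviving index is [k - r], since [k + 4 (k - r) = q - 1]; the next multiple [2 (q - 1)]
    exceeds the largest exponent [5 k]. *)
Lemma quintic_inj_bin (k r : nat) : (5 * k = q - 1 + 4 * r)%N ->
  (4 * r < q - 1)%N -> {in V &, injective H} -> 'C(k, r)%:R * a ^+ r = 0.
Proof.
move=> Ek lt_r injH; have q3 := q_ge3.
have le_rk : (r <= k)%N by lia.
rewrite -(bin_sub le_rk) -{2}(subKn le_rk).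
apply: hermite_single => //; [lia | lia | by apply/dvdnP; exists 1%N; lia |].
move=> i le_i /dvdnP[n En].
case: n En => [|[|n]] En; [lia | lia | nia].
Qed.

(** For [r = 0] the single surviving term is 1, whatever [a] is. *)
Lemma quintic_noninj_mod1 : (q %% 5 = 1)%N -> ~ {in V &, injective H}.
Proof.
move=> q1 injH; have q3 := q_ge3.
have := @quintic_inj_bin ((q - 1) %/ 5) 0 _ _ injH.
rewrite bin0 mulr1 => /(_ ltac:(lia) ltac:(lia))/eqP.
by rewrite oner_eq0.
Qed.

(** For [k = 4] two terms survive, [i = 1] and [i = 3], giving [4 a - 4 a^3 = 0]. *)
Lemma quintic_inj9 : q = 9%N -> {in V &, injective H} -> a != 0 -> a ^+ 2 = 1.
Proof.
move=> q9 injH a0; have := hermite injH (k := 4).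
rewrite q9 big_mkcond !big_ord_recr big_ord0 /= => /(_ isT).
have -> : ((4 + 4 * 1) %/ 8 = 1)%N by [].
have -> : ((4 + 4 * 3) %/ 8 = 2)%N by [].
rewrite -['C(4, 1)]/4%N -['C(4, 3)]/4%N => sum0.
have three0 : 3%:R = 0 :> L by apply/pcharf0/pchar_dvdq; rewrite ?q9.
apply/(mulfI a0)/eqP; rewrite -subr_eq0 -(oppr0 L) -sum0 -subr_eq0.
apply/eqP; transitivity (3%:R * (a - a ^+ 3)); first by ring.
by rewrite three0 mul0r.
Qed.

(** On [V] one has [z^3 = - z], hence [z^5 = z], so [a = -1] would make [H] vanish on [V]. *)
Lemma quintic_inj3 : q = 3%N -> {in V &, injective H} -> a != -1.
Proof.
move=> q3 injH; apply/negP => /eqP a1.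
have [x] := exists_antifixed.
have: (x ^+ q - x) ^+ q = - (x ^+ q - x) by rewrite expqB expqK opprB.
move: (x ^+ q - x) => v vV /negP[]; apply/eqP.
apply: injH; rewrite ?antifixed0 ?inE ?vV //.
rewrite q3 in vV; rewrite a1 (exprD _ 3 2) vV mulNr -exprS vV.
by rewrite expr0n /= mulr0; ring.
Qed.

Lemma quintic_inj : (q %% 5 != 0)%N -> a != 0 -> {in V &, injective H} ->
  (q = 3%N /\ a != -1) \/ (q = 9%N /\ a ^+ 2 = 1).
Proof.
move=> q5 a0 injH.
have [p [m [p_pr p_odd m_gt0 Eq pcharL]]] := prime_power_pchar.
have q3 := q_ge3.
have dvd_bin (k r : nat) : (5 * k = q - 1 + 4 * r)%N -> (4 * r < q - 1)%N ->
    (p %| 'C(k, r))%N.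
  move=> Ek lt_r; have /eqP := quintic_inj_bin Ek lt_r injH.
  by rewrite mulf_eq0 expf_eq0 (negPf a0) andbF orbF (dvdn_pcharf pcharL).
have p_dvdq : (p %| q)%N by rewrite Eq dvdn_exp.
have eq_p (l : nat) : prime l -> (p %| l)%N -> p = l.
  by move=> l_pr; rewrite dvdn_prime2 // => /eqP.
(* Each factor [x] of the falling factorial of [k] satisfies [5 x = q + c] with a small constant
   [c], which confines [p] to the prime divisors of [c]. *)
have dvd_const (x c : nat) : (p %| x)%N -> (5 * x = q + c)%N -> (p %| c)%N.
  by move=> px Ex; rewrite -(dvdn_addr c p_dvdq) -Ex dvdn_mull.
have dvd_ffact (k r : nat) : (p %| 'C(k, r))%N -> (p %| k ^_ r)%N.
  by rewrite -bin_ffact; apply: dvdn_mulr.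
have: (q %% 5 < 5)%N by rewrite ltn_mod.
case Er: (q %% 5)%N q5 => [|[|[|[|[|]]]]] // _ _.
- by case: (quintic_noninj_mod1 Er injH).
- have := dvd_bin ((q + 3) %/ 5)%N 1%N ltac:(lia) ltac:(lia).
  rewrite bin1 => /dvd_const => /(_ 3%N ltac:(lia)) /eq_p => /(_ isT) p3.
  subst p; case/negP: a0; apply/eqP.
  (* For even [m], [q] is a power of 9, hence 1 or -1 modulo 5, whereas here it is 2. *)
  have m_odd : odd m.
    apply/negPn/negP => m_even.
    have : (q %% 5 = 1 \/ q %% 5 = 4)%N.
      rewrite Eq -(odd_double_half m) (negPf m_even) -muln2 mulnC expnM.
      rewrite -[(3 ^ 2)%N]/9%N.
      by elim: (m./2) => [|n IH]; [left | rewrite expnS; lia].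
    by rewrite Er; case.
  move: Eq; rewrite -(odd_double_half m) m_odd add1n => Eq.
  apply: (quintic_inj_pow3 pcharL _ Eq injH).
  by case: (m./2) Eq Er => // ->.
- have [q_eq3|q_neq3] := eqVneq q 3%N.
    by left; split; last exact: quintic_inj3.
  (* Five times [k] and [k - 1] is [q + 7] and [q + 2], so [p] divides 7 or 2. *)
  have := dvd_bin ((q + 7) %/ 5)%N 2%N ltac:(lia) ltac:(lia).
  move/dvd_ffact; rewrite ffactnS ffactn1 Euclid_dvdM // => /orP[] pk.
    have p7 := eq_p 7%N isT (dvd_const _ 7%N pk ltac:(lia)); subst p.
    by case/negP: a0; apply/eqP; apply: quintic_inj_pow7 pcharL Eq injH.
  have p2 := eq_p 2%N isT (dvd_const _ 2%N pk ltac:(lia)).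
  by rewrite p2 in p_odd.
- have [q_eq9|q_neq9] := eqVneq q 9%N.
    by right; split; last exact: quintic_inj9.
  set k := ((q + 11) %/ 5)%N.
  have dvdC := dvd_bin k 3%N ltac:(lia) ltac:(lia).
  (* Five times [k], [k - 1] and [k - 2] is [q + 11], [q + 6] and [q + 1]. *)
  have p3 : p = 3%N.
    move: (dvdC) => /dvd_ffact.
    rewrite !ffactnS ffactn0 muln1 !Euclid_dvdM // => /or3P[] pk.
    - have p11 := eq_p 11%N isT (dvd_const _ 11%N pk ltac:(lia)).
      have : (q %% 5 = 1)%N by rewrite Eq p11 -modnXm exp1n.
      by rewrite Er.
    - have : (p %| 2 * 3)%N by apply: dvd_const pk _; lia.
      rewrite Euclid_dvdM // => /orP[/eq_p p2|/eq_p]; last exact.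
      by move: p_odd; rewrite p2.
    - have : (p %| 1)%N by apply: dvd_const pk _; lia.
      by rewrite dvdn1 => /eqP p1; rewrite p1 in p_pr.
  (* Here 27 divides [q], so [5 k = q + 11] forces [k = 4] modulo 9. Then [k (k - 1) (k - 2)] is 24
     modulo 9, whereas [3] dividing ['C(k, 3)] would make it a multiple of 9. *)
  have [u Eu] : exists u, k = (9 * u + 4)%N.
    exists (k %/ 9)%N; move: Eq Er q_neq9 m_gt0; rewrite p3 /k.
    case: (m) => [|[|[|n]]] // -> //; rewrite !expnS; lia.
  move: dvdC; rewrite p3 => /dvdnP[c Ec].
  have := bin_ffact k 3; rewrite Ec Eu !ffactnS ffactn0 muln1.
  have -> : ((9 * u + 4) * ((9 * u + 4).-1 * (9 * u + 4).-2) =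
      9 * (81 * u ^ 3 + 81 * u ^ 2 + 26 * u) + 24)%N.
    have -> : (9 * u + 4).-1 = (9 * u + 3)%N by lia.
    have -> : (9 * u + 3).-1 = (9 * u + 2)%N by lia.
    ring.
  by rewrite (factS 2) => ?; lia.
Qed.

(** A ratio [u] of two nonzero elements of [V] with equal fifth powers satisfies
    [u^5 = u^(q-1) = 1], and these exponents are coprime. *)
Lemma pow5_inj : (q %% 5 != 1)%N -> {in V &, injective (fun z : L => z ^+ 5)}.
Proof.
move=> q1 z1 z2; rewrite !inE => /eqP z1q /eqP z2q /= E5.
have q3 := q_ge3.
have [z20|z20] := eqVneq z2 0.
  by move/eqP: E5; rewrite z20 expr0n expf_eq0 => /andP[_ /eqP].
pose u := z1 / z2.
have u5 : u ^+ 5 = 1 by rewrite expr_div_n E5 divff // expf_neq0.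
have u0 : u != 0.
  by apply/negP => /eqP u0; move/eqP: u5; rewrite u0 expr0n eq_sym oner_eq0.
have uq : u ^+ (q - 1) = 1.
  apply: (mulfI u0); rewrite -exprS mulr1 subn1 prednK; last by lia.
  by rewrite expr_div_n z1q z2q invrN mulrNN.
have [n [l E]] : exists n l, (n * (q - 1) + 1 = 5 * l)%N.
  have : (q %% 5 < 5)%N by rewrite ltn_mod.
  case Er: (q %% 5)%N q1 => [|[|[|[|[|]]]]] // _ _.
  - by exists 1%N, (q %/ 5)%N; lia.
  - by exists 4%N, (4 * (q %/ 5) + 1)%N; lia.
  - by exists 2%N, (2 * (q %/ 5) + 1)%N; lia.
  - by exists 3%N, (3 * (q %/ 5) + 2)%N; lia.
have : u ^+ (n * (q - 1) + 1) = 1 by rewrite E exprM u5 expr1n.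
by rewrite exprD mulnC exprM uq expr1n mul1r expr1 => /divr1_eq.
Qed.

(* On V one has (H z)^4 = - z^4, so H z determines z = H z / (a - (H z)^4). *)
Lemma quintic_inj9_suff : q = 9%N -> a ^+ 2 = 1 -> {in V &, injective H}.
Proof.
move=> q9 a2.
have three0 : 3%:R = 0 :> L by apply/pcharf0/pchar_dvdq; rewrite ?q9.
have a0 : a != 0 by rewrite -sqrf_eq0 a2 oner_eq0.
have pow8 z : z \in V -> z != 0 -> z ^+ 8 = -1.
  by move=> zV z0; have := antifixed_powq1 zV z0; rewrite q9.
have pow4 z : z \in V -> H z ^+ 4 = - z ^+ 4.
  move=> zV; have [->|z0] := eqVneq z 0; first by rewrite !expr0n mulr0 /=; ring.
  (* Written so that [z^8 = -1] and [a^2 = 1] cancel inside the square. *)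
  have -> : H z ^+ 4 = z ^+ 4 * ((z ^+ 8 + a ^+ 2 + 2%:R * a * z ^+ 4) ^+ 2).
    by ring.
  rewrite (pow8 z) // a2 addNr add0r.
  have -> : (2%:R * a * z ^+ 4) ^+ 2 = 4%:R * a ^+ 2 * z ^+ 8 by ring.
  rewrite (pow8 z) // a2; transitivity (- z ^+ 4 - 3%:R * z ^+ 4); first by ring.
  by rewrite three0 mul0r subr0.
have recover z : z \in V -> z * (a - H z ^+ 4) = H z.
  by move=> zV; rewrite pow4 //; ring.
move=> z1 z2 z1V z2V /= E.
have Ew : z1 * (a - H z2 ^+ 4) = z2 * (a - H z2 ^+ 4).
  by rewrite /= (recover z2 z2V) -E recover.
apply: (mulIf _ Ew); rewrite /= pow4 // opprK.
have [->|z20] := eqVneq z2 0; first by rewrite expr0n addr0.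
(* The factor to cancel is nonzero: [a = - z2^4] would give [a^2 = z2^8 = -1]. *)
apply/negP; rewrite addr_eq0 => /eqP aE.
have /eqP : 2%:R = 0 :> L.
  rewrite mulr2n -{1}a2 aE sqrrN -exprM (pow8 z2) //; ring.
by rewrite (negPf natr2_neq0).
Qed.

(** In characteristic 5 the map is additive, so injectivity means a trivial kernel, and
    [H z = z (z^4 + a)]. *)
Lemma quintic_additive : (5 %| q)%N ->
  {in V &, injective H} <-> ~ exists z, [/\ z \in V, z != 0 & z ^+ 4 = - a].
Proof.
move=> q5; have pchar5 : 5%N \in [pchar L] by apply: pchar_dvdq.
split=> [injH [z [zV z0 z4]]|nroot z1 z2 z1V z2V E].
  move/negP: z0; apply; apply/eqP/injH; rewrite ?antifixed0 //.
  by rewrite (exprSr z 4) z4 expr0n /= mulr0; ring.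
apply/eqP; rewrite -subr_eq0; apply/negPn/negP => z0.
case: nroot; exists (z1 - z2); split=> //.
  move: z1V z2V; rewrite !inE expqB => /eqP-> /eqP->; apply/eqP; ring.
apply/eqP; rewrite -addr_eq0 -(mulIr_eq0 _ (mulIf z0)); apply/eqP.
transitivity ((z1 - z2) ^+ 5 + a * (z1 - z2)); first by ring.
rewrite exprDn_pchar ?pnatE // exprNn (_ : (-1) ^+ 5 = -1 :> L); last by ring.
transitivity (H z1 - H z2); first by ring.
by rewrite E subrr.
Qed.

End Quintic.

(** * Fourth roots of trace zero, and the reduction of [f] to the quintic *)

(** A nonzero [s] is [g^e] with [q + 1] dividing [e], and [q + 1] is even. *)
Lemma fixed_sqrt (s : L) : s ^+ q = s -> exists z, z ^+ 2 = s.
Proof.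
move=> sq; have [->|s0] := eqVneq s 0; first by exists 0; rewrite expr0n.
have q3 := q_ge3; have [g gP] := primitive_root_exists.
have Eq2 : (q ^ 2 - 1 = (q + 1) * (q - 1))%N by nia.
have s1 : s ^+ (q - 1) = 1.
  by apply: (mulfI s0); rewrite -exprS mulr1 subn1 prednK //; lia.
have : s ^+ (q ^ 2 - 1) = 1 by rewrite Eq2 mulnC exprM s1 expr1n.
case/(prim_rootP gP) => -[e _] /= Es; exists (g ^+ (e %/ 2)%N).
rewrite -exprM divnK //.
have : g ^+ (e * (q - 1)) == 1 by rewrite exprM -Es s1.
rewrite -(prim_order_dvd gP) Eq2 dvdn_pmul2r; last by lia.
apply: dvdn_trans; rewrite dvdn2 oddD q_odd //.
Qed.

(** If [z^4 = y^4] with [y] in [K], raising to the power [(q - 1) / 4] gives [-1 = 1]. Conversely,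
    if [b = s^2] and [z^2 = s], then [z^q] is [z] or [- z], and the first makes [b] a fourth power
    in [K]. *)
Lemma antifixed_fourth_root (K : {set L}) (b : L) :
  subfield_of_order q K -> b \in K -> (q %% 4 = 1)%N ->
  (exists z, [/\ z \in V, z != 0 & z ^+ 4 = b]) <->
  (power_in K 2 b /\ ~ power_in K 4 b).
Proof.
move=> hK bK q4; have fixK x := subfield_fixed x hK.
split=> [[z [zV z0 zb]]|[[s sK bs] n4]].
  split; first exists (z ^+ 2); rewrite -?exprM //.
    by move: zV; rewrite inE fixK -exprM mulnC exprM => /eqP->; rewrite sqrrN.
  case=> y; rewrite fixK -zb => /eqP yq zy.
  have y0 : y != 0.
    by apply: contraNneq z0 => y0; move/eqP: zy; rewrite y0 expr0n expf_eq0.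
  have z1 := antifixed_powq1 zV z0.
  have q3 := q_ge3.
  have y1 : y ^+ (q - 1) = 1.
    by apply: (mulfI y0); rewrite -exprS mulr1 subn1 prednK //; lia.
  have E : (q - 1 = 4 * (q %/ 4))%N by lia.
  have /eqP : 2%:R = 0 :> L.
    rewrite mulr2n -{1}y1 E exprM -zy -exprM -E z1; ring.
  by rewrite (negPf natr2_neq0).
have [z zs] := fixed_sqrt (eqP (etrans (esym (fixK s)) sK)).
have zb : z ^+ 4 = b by rewrite bs -zs -exprM.
have: (z ^+ q) ^+ 2 == z ^+ 2.
  by rewrite -exprM mulnC exprM zs -fixK.
rewrite eqf_sqr => /orP[zK|zV].
  by case: n4; exists z; rewrite ?fixK.
exists z; split; rewrite ?inE //.
apply: contra_notN n4 => /eqP z0; exists 0; rewrite -?zb ?z0 // fixK expr0n.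
by rewrite gtn_eqF //; have := q_ge3; lia.
Qed.

(* With T = Tr delta and y = x^q - x + delta = T / 2 + z one has y^q = T / 2 - z,
   and f^q - f is a polynomial in z alone. *)
Lemma permutation_poly_antifixed (delta gamma : L) :
  gamma ^+ q = gamma -> gamma != 0 ->
  permutation_poly
    (('X^q - 'X + delta%:P) ^+ (q + 5) + ('X^q - 'X + delta%:P) ^+ (2 * q)
      + gamma%:P * 'X)
  <->
  {in V &, injective (fun z : L => 4%:R * Tr q delta * z ^+ 5 +
     (gamma + 2%:R * Tr q delta - Tr q delta ^+ 5 / 4%:R) * z)}.
Proof.
move=> gq g0; set f := (_ + _ + _).
set T := Tr q delta; set G := (X in injective X).
have two0 := natr2_neq0.
have deltaq : delta ^+ q = T - delta by rewrite /T /Tr addrC addKr.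
have fE x : f.[x] = (x ^+ q - x + delta) ^+ (q + 5)
    + (x ^+ q - x + delta) ^+ (2 * q) + gamma * x.
  by rewrite /f !(hornerE, hornerXn).
clearbody f; clearbody T.
pose zeta (x : L) : L := x ^+ q - x + delta - T / 2%:R.
have Tq : T ^+ q = T.
  have -> : T = delta + delta ^+ q by rewrite deltaq; ring.
  by rewrite expqD expqK addrC.
have half_q : (T / 2%:R) ^+ q = T / 2%:R by rewrite exprMn exprVn expq_nat Tq.
have zetaV x : zeta x \in V.
  rewrite inE /zeta expqB expqD expqB expqK half_q deltaq.
  by apply/eqP; field.
have frob_f x : f.[x] ^+ q - f.[x] = G (zeta x) + gamma * (T / 2%:R - delta).
  rewrite fE; set y := x ^+ q - x + delta.
  have yq : y ^+ q = T - y.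
    by rewrite /y expqD expqB expqK deltaq; ring.
  have Eh : y ^+ (q + 5) + y ^+ (2 * q) = (T - y) * y ^+ 5 + (T - y) ^+ 2.
    by rewrite exprD mulnC exprM yq.
  have xq : x ^+ q = y + x - delta by rewrite /y; ring.
  have zeta_x : zeta x = y - T / 2%:R by [].
  clearbody y; have Tyq : (T - y) ^+ q = y by rewrite expqB Tq yq; ring.
  have E5 : ((T - y) * y ^+ 5) ^+ q = y * (T - y) ^+ 5.
    by rewrite exprMn Tyq exprAC yq.
  have E2 : ((T - y) ^+ 2) ^+ q = y ^+ 2 by rewrite exprAC Tyq.
  rewrite Eh !expqD E5 E2 exprMn gq xq zeta_x /G; field.
  by rewrite two0 natr4_neq0.
split=> [/bij_inj injf z1 z2|injG].
  move=> z1V z2V EG; have {}EG : G z1 = G z2 by [].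
  have lift z : z \in V -> exists x, zeta x = z.
    move=> zV; have : z + T / 2%:R - delta \in V.
      move: zV; rewrite !inE expqB expqD half_q deltaq => /eqP->.
      by apply/eqP; field.
    by case/antifixed_image => x Ex; exists x; rewrite /zeta Ex; ring.
  have [x1 Ex1] := lift z1 z1V; have [x2 Ex2] := lift z2 z2V.
  (* Shifting [x2] by an element [c] of F_q keeps [zeta] and adds [gamma c] to the value of [f];
     this [c] produces a collision with [x1]. *)
  pose c := (f.[x1] - f.[x2]) / gamma.
  have cq : c ^+ q = c.
    rewrite /c exprMn exprVn gq expqB; congr (_ / _).
    apply/eqP; rewrite -subr_eq0; apply/eqP.
    transitivity ((f.[x1] ^+ q - f.[x1]) - (f.[x2] ^+ q - f.[x2])).
      by ring.
    by rewrite !frob_f Ex1 Ex2 EG subrr.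
  have zc : zeta (x2 + c) = zeta x2 by rewrite /zeta expqD cq; ring.
  have Ex : (x2 + c) ^+ q - (x2 + c) = x2 ^+ q - x2 by rewrite expqD cq; ring.
  have : f.[x2 + c] = f.[x1].
    rewrite fE Ex mulrDr addrA -fE /c mulrC divfK //; ring.
  by move/injf => Ec; rewrite -Ex1 -Ex2 -Ec zc.
apply: injF_bij => x1 x2 Ef.
have Ez : zeta x1 = zeta x2.
  apply: injG => //; apply: (addIr (gamma * (T / 2%:R - delta))).
  by rewrite -!frob_f Ef.
have Ey : x1 ^+ q - x1 + delta = x2 ^+ q - x2 + delta by apply: addIr Ez.
by move: Ef; rewrite !fE Ey => /addrI /(mulfI g0).
Qed.

End QuadraticExtension.

(** * The classification of the permutation polynomials *)

Theorem theorem3p12 (q : nat) (hq : prime_power q) (hodd : odd q)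
  (L : finFieldType) (hL : #|L| = (q ^ 2)%N)
  (K : {set L}) (hK : subfield_of_order q K)
  (delta gamma : L) (hgamma : gamma \in K) (hgamma0 : gamma != 0) :
  permutation_poly
    (('X^q - 'X + delta%:P) ^+ (q + 5) + ('X^q - 'X + delta%:P) ^+ (2 * q)
      + gamma%:P * 'X)
  <->
  [\/ Tr q delta = 0,
      [/\ Tr q delta != 0, (q != 1 %[mod 5])%N
        & gamma = Tr q delta ^+ 5 / 4%:R - 2%:R * Tr q delta],
      [/\ Tr q delta != 0, (5 %| q)%N
        & power_in K 4
            ((Tr q delta ^+ 5 + 2%:R * Tr q delta + gamma) / Tr q delta)
          \/ ~ power_in K 2
            ((Tr q delta ^+ 5 + 2%:R * Tr q delta + gamma) / Tr q delta)]
    | [/\ Tr q delta != 0, q = 9%N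
        & gamma = Tr q delta ^+ 5 \/ gamma = Tr q delta ^+ 5 - Tr q delta]].
Proof.
have fixK x := subfield_fixed hq hodd hL x hK.
have gq : gamma ^+ q = gamma by apply/eqP; rewrite -fixK.
rewrite permutation_poly_antifixed //; set T := Tr q delta.
have Tq : T ^+ q = T by rewrite /T /Tr expqD // expqK // addrC.
have two0 : 2%:R != 0 :> L := natr2_neq0 hq hodd hL.
have four0 : 4%:R != 0 :> L := natr4_neq0 hq hodd hL.
set A := gamma + _ - _; clearbody T.
have [T0|T0] := eqVneq T 0.
  split=> [_|_]; first by constructor 1.
  move=> z1 z2 _ _; rewrite /A T0 !mulr0 !mul0r !add0r expr0n mul0r.
  by rewrite subr0 addr0; apply: mulfI.
pose a := A / (4%:R * T).
have fT0 : 4%:R * T != 0 by rewrite mulf_neq0.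
have Aq : A ^+ q = A.
  have T5q : (T ^+ 5) ^+ q = T ^+ 5 by rewrite exprAC Tq.
  rewrite /A expqB // expqD // (exprMn _ (T ^+ 5)) (exprMn _ 2%:R).
  by rewrite exprVn !expq_nat // gq T5q Tq.
have aq : a ^+ q = a by rewrite /a exprMn exprVn exprMn expq_nat // Tq Aq.
have scaleG z : 4%:R * T * z ^+ 5 + A * z = 4%:R * T * (z ^+ 5 + a * z).
  by rewrite mulrDr [X in _ = _ + X]mulrA [_ * a]mulrC divfK.
have -> : {in antifixed L q &, injective (fun z => 4%:R * T * z ^+ 5 + A * z)}
    <-> {in antifixed L q &, injective (fun z => z ^+ 5 + a * z)}.
  split=> inj z1 z2 z1V z2V E; apply: inj => //; move: E; rewrite !scaleG.
    by move->.
  exact: mulfI.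
have a_eq0 : (a == 0) = (gamma == T ^+ 5 / 4%:R - 2%:R * T).
  rewrite mulf_eq0 invr_eq0 (negPf fT0) orbF /A -[RHS]subr_eq0.
  by congr (_ == 0); ring.
have criterion5 : (5 %| q)%N ->
    {in antifixed L q &, injective (fun z => z ^+ 5 + a * z)} <->
    (power_in K 4 ((T ^+ 5 + 2%:R * T + gamma) / T) \/
     ~ power_in K 2 ((T ^+ 5 + 2%:R * T + gamma) / T)).
  move=> q5; have five0 : 5%:R = 0 :> L by apply/pcharf0/(pchar_dvdq hq hodd hL).
  (* In characteristic 5 one has [4 = -1]. *)
  have -> : (T ^+ 5 + 2%:R * T + gamma) / T = - a.
    apply/eqP; rewrite -subr_eq0; apply/eqP.
    transitivity (5%:R * (3%:R * T ^+ 5 + 8%:R * T + 4%:R * gamma) /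
                  (4%:R * (4%:R * T))).
      by rewrite /a /A; field; rewrite T0 four0.
    by rewrite five0 !mul0r.
  have q4 : (q %% 4 = 1)%N.
    have [p [m [p_pr _ m_gt0 Eq _]]] := prime_power_pchar hq hodd hL.
    have p5 : p = 5%N.
      by move: q5; rewrite Eq Euclid_dvdX // dvdn_prime2 // => /andP[/eqP].
    by rewrite Eq p5 -modnXm exp1n.
  have aK : - a \in K by rewrite fixK expqN // aq.
  apply: (iff_trans (quintic_additive hq hodd hL a q5)).
  have root := antifixed_fourth_root hq hodd hL hK aK q4.
  split=> [nroot|crit /root[P2 nP4]]; last by case: crit.
  (* Finiteness of [L] makes being a fourth power decidable. *)
  have [P4|nP4] := power_inP K 4 (- a); first by left.
  by right=> P2; apply/nroot/root.
have a_char3 : (3 %| q)%N ->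
    3%:R = 0 :> L /\ a = (gamma + 2%:R * T - T ^+ 5) / T.
  move=> q3; have three0 : 3%:R = 0 :> L by apply/pcharf0/(pchar_dvdq hq hodd hL).
  have four1 : 4%:R = 1 :> L by rewrite -[LHS]/(1 + 3%:R) three0 addr0.
  by split=> //; rewrite /a /A four1 divr1 mul1r.
split.
  move=> inj; have [q5|q5] := boolP (5 %| q)%N.
    by constructor 3; split=> //; apply/criterion5.
  have q1 : (q %% 5 != 1)%N by apply/eqP => q1; apply: quintic_noninj_mod1 inj.
  have [a0|a0] := eqVneq a 0.
    by constructor 2; split=> //; apply/eqP; rewrite -a_eq0 a0.
  have [[q3 a1]|[q9 a2]] := quintic_inj hq hodd hL aq q5 a0 inj.
    have [three0 aE] := a_char3 ltac:(by rewrite q3).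
    move: gq Tq; rewrite q3 => g3 T3.
    have T5 : T ^+ 5 = T by rewrite (exprD _ 3 2) T3 -exprS.
    have sq1 (x : L) : x != 0 -> x ^+ 3 = x -> x ^+ 2 = 1.
      by move=> x0 x3; apply: (mulfI x0); rewrite -exprS x3 mulr1.
    (* In F_3 the nonzero [gamma] and [T] agree up to sign; [gamma = T] gives [a = -1] and
       [gamma = - T] gives [a = 0], both already excluded. *)
    have : gamma ^+ 2 == T ^+ 2 by rewrite !sq1.
    rewrite eqf_sqr => /orP[] /eqP gT.
      case/eqP: a1; rewrite aE gT T5; transitivity (3%:R - 1 : L); last first.
        by rewrite three0 add0r.
      by field.
    by case/eqP: a0; rewrite aE gT T5; field.
  have [three0 aE] := a_char3 ltac:(by rewrite q9).
  constructor 4; split=> //.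
  (* Solving for [gamma]: [a = 1] gives [T^5 - T], and [a = -1] gives [T^5 - 3 T = T^5]. *)
  have g_a : gamma = a * T - 2%:R * T + T ^+ 5 by rewrite aE; field.
  move/eqP: a2; rewrite sqrf_eq1 => /orP[] /eqP a1; rewrite g_a a1.
    by right; ring.
  left; transitivity (T ^+ 5 - 3%:R * T); first by ring.
  by rewrite three0 mul0r subr0.
case=> [/eqP|[_ q1 gE]|[_ q5 crit]|[_ q9 gE]].
- by rewrite (negPf T0).
- have -> : a = 0 by apply/eqP; rewrite a_eq0 gE.
  by move=> z1 z2 z1V z2V; rewrite !mul0r !addr0; apply: pow5_inj q1 _ _ z1V z2V.
- exact/criterion5.
apply: quintic_inj9_suff => //.
have [three0 ->] := a_char3 ltac:(by rewrite q9).
have [->|->] := gE; last by field.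
transitivity ((3%:R - 1 : L) ^+ 2); first by field.
by rewrite three0 add0r sqrrN expr1n.
Qed.
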